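(* For each real $\epsilon$ with $0<\epsilon<\sqrt{2/\pi}$ there is an integer $N_\epsilon$ such that $$\left\lceil\frac{-1}{2\log 2}\,W_{-1}\!\left(\frac{-4\log 2}{\pi n^2}\right)\right\rceil\leq s(n)\leq\left\lceil\frac{-1}{2\log 2}\,W_{-1}\!\left(\frac{-2\alpha^2\log 2}{n^2}\right)\right\rceil$$ for all integers $n\geq N_\epsilon$, where $\alpha=\sqrt{\frac{2}{\pi}}-\epsilon$.
   Context: $\log$ is the natural logarithm. For a natural number $n\ge 1$, $s(n)$ is the smallest positive integer $k$ such that $\binom{k}{\lfloor k/2\rfloor}\geq n$. $W_{-1}:[-1/e,0)\to(-\infty,-1]$ is the second real branch of the Lambert $W$ function, i.e. the inverse of the strictly decreasing bijection $(-\infty,-1]\to[-1/e,0)$, $w\mapsto we^w$. *)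

(* Defs.v *)
From mathcomp Require Import all_boot all_order all_algebra.
From mathcomp Require Import all_classical all_reals all_analysis.
From mathcomp Require Import ring lra.

Set Implicit Arguments.
Unset Strict Implicit.
Unset Printing Implicit Defensive.

Import Order.TTheory GRing.Theory Num.Theory.
Import numFieldNormedType.Exports.

Local Open Scope classical_set_scope.
Local Open Scope ring_scope.

Lemma ex_central_bin_ge (n : nat) :
  exists k : nat, (0 < k)%N && (n <= 'C(k, k./2))%N.
Proof.
have bin_ge k : (k <= 'C(k, k./2))%N.
  elim: k => [|k IHk] //.
  have [->//|k0] := posnP k.
  have bin_gt0' j : (j <= k)%N -> (0 < 'C(k, j))%N by rewrite bin_gt0.
  rewrite /= uphalfE; case: (boolP (odd k)) => ok.
  - have -> : (k.+1)./2 = (k./2).+1 by rewrite -uphalfE uphalf_half ok.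
    rewrite binS addnC -addn1 leq_add //; apply: bin_gt0'.
    by rewrite -{2}(odd_double_half k) ok -addnn add1n ltnS leq_addr.
  - have ek : (k.+1)./2 = k./2 by rewrite -uphalfE uphalf_half (negbTE ok).
    have h0 : (0 < k./2)%N.
      by rewrite half_gt0; case: k k0 ok {IHk bin_gt0' ek} => [|[|]].
    rewrite ek -(prednK h0) binS (prednK h0) -addn1 leq_add //; apply: bin_gt0'.
    rewrite (leq_trans (leq_pred _)) //.
    by rewrite -{2}(odd_double_half k) -addnn addnCA leq_addr.
exists n.+1; rewrite /=.
exact: leq_trans (leqnSn n) (bin_ge n.+1).
Qed.

Definition s (n : nat) : nat := ex_minn (ex_central_bin_ge n).

Section LambertW.
Context {R : realType}.

(* Meaningful on [-1/e, 0[ only, by lambertWm1_set_bij; [pinv] returns an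
   unspecified value elsewhere. *)
Definition lambertWm1 : R -> R :=
  pinv `]-oo, (-1 : R)] (fun w : R => w * expR w).

Lemma mul_expR_decr (a b : R) : b <= -1 -> a < b -> b * expR b < a * expR a.
Proof.
move=> b1 ab.
have -> : b = a + (b - a) by ring.
set d := b - a; have d0 : 0 < d by rewrite subr_gt0.
rewrite expRD mulrCA [ltRHS]mulrC ltr_pM2l ?expR_gt0//.
have -> : a = b - d by rewrite /d; ring.
have ed : 1 + d < expR d by apply: expR_gt1Dx; rewrite gt_eqF.
by nra.
Qed.

Lemma mul_expR_set_bij :
  set_bij `]-oo, (-1 : R)] `[(- expR (-1)), 0[ (fun w : R => w * expR w).
Proof.
split.
- move=> w /=; rewrite !in_itv/= => w1; apply/andP; split; last first.
    by rewrite nmulr_rlt0 ?expR_gt0//; lra.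
  move: w1; rewrite le_eqVlt => /predU1P[->|w1]; first by rewrite mulN1r.
  by rewrite -[- expR _]mulN1r ltW// mul_expR_decr.
- move=> a b; rewrite !inE/= !in_itv/= => a1 b1 ab.
  apply/eqP; case: ltgtP => // h.
  + by have := mul_expR_decr b1 h; rewrite ab ltxx.
  + by have := mul_expR_decr a1 h; rewrite ab ltxx.
- move=> y /=; rewrite in_itv/= => /andP[ey y0].
  pose m := Num.min (-1) (2 / y).
  have m1 : m <= -1 by rewrite /m ge_min lexx.
  have my : m <= 2 / y by rewrite /m ge_min lexx orbT.
  have fm : y <= m * expR m.
    have m0 : m < 0 by lra.
    have ge : 1 + (- m) ^+ 2 / 2 <= expR (- m).
      by apply: (@expR_ge1Dxn R (- m) 1); lra.
    have ym : 2 <= m * y.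
      have yi : y^-1 < 0 by rewrite invr_lt0.
      have -> : 2 = (2 / y) * y by rewrite divfK// lt_eqF.
      by rewrite ler_nM2r.
    have e0 := expR_gt0 m.
    have ee : expR (- m) * expR m = 1 by rewrite -expRD addNr expR0.
    have ye : y * expR (- m) <= m.
      have : y * expR (- m) <= y * (1 + (- m) ^+ 2 / 2) by rewrite ler_nM2l.
      by rewrite expr2; nra.
    have := ler_wpM2r (ltW e0) ye.
    by rewrite -mulrA ee mulr1.
  have cf : {within `[m, -1], continuous (fun w : R => w * expR w)}.
    apply: continuous_subspaceT => x; apply: cvgM; first exact: cvg_id.
    exact: continuous_expR.
  have [|c] := IVT m1 cf (v := y).
    rewrite mulN1r ge_min le_max ey orbT fm /=; exact: erefl.
  rewrite in_itv/= => /andP[_ c1] fc.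
  by exists c => //=; rewrite in_itv.
Qed.

Lemma lambertWm1_set_bij :
  set_bij `[(- expR (-1) : R), 0[ `]-oo, (-1 : R)] lambertWm1.
Proof. exact: bijpinv_bij mul_expR_set_bij. Qed.

Lemma lambertWm1K :
  {in `[(- expR (-1) : R), 0[, cancel lambertWm1 (fun w : R => w * expR w)}.
Proof.
have [_ _ sj] := mul_expR_set_bij.
by move=> y yI; apply: (surjpK (fun=> point) sj); rewrite inE.
Qed.

End LambertW.

(* Main.v *)
Require Import Defs.
From mathcomp Require Import all_boot all_order all_algebra.
From mathcomp Require Import all_classical all_reals all_analysis.
From mathcomp Require Import ring lra.

Set Implicit Arguments.
Unset Strict Implicit.

Import Order.TTheory GRing.Theory Num.Theory.

Local Open Scope ring_scope.

(** Write b(k) for the central binomial coefficient 'C(k, k./2). The theorem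
    rests on the two-sided estimate

      2/pi * 4^k/(k+2) <= b(k)^2 <= 2/pi * 4^k/k

    ([cbin_sqr_ge], [cbin_sqr_le]), which is Wallis' product in disguise. The
    integrals W_n of sin^n over [0, pi/2] satisfy W_(n+2) = (n+1)/(n+2) W_n, so
    b(k) is 2^k (2/pi) times W_k for even k and times W_(k+1) for odd k. As
    W_n decreases and n W_n W_(n-1) is the constant pi/2, W_n^2 lies between
    pi/(2(n+1)) and pi/(2n).

    The branch W_(-1) inverts such an estimate: substituting w = -2x log 2
    turns w e^w into -2 log 2 / (4^x/x), so that for c > 0 the number
    x = -W_(-1)(-2 c log 2/n^2)/(2 log 2) solves c 4^x/x = n^2 on the half-line
    x >= 1/(2 log 2), where 4^x/x increases. With c = 2/pi, the upper estimate
    together with n <= b(s(n)) gives x <= s(n). With c = alpha^2 < 2/pi, the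
    lower estimate gives b(k)^2 >= c 4^k/k for all large k; at k = ceil x,
    which is large when n is, this yields b(k) >= n, hence s(n) <= k. *)

(** * Wallis integrals *)

(** The primitive of sin^n vanishing at 0, given by the reduction formula
    rather than as an integral: its derivative and its value at pi/2 then
    follow by induction, without integration by parts. *)
Fixpoint sin_prim {R : realType} (n : nat) (x : R) : R :=
  match n with
  | 0 => x
  | 1 => 1 - cos x
  | m.+2 => (m.+1%:R * sin_prim m x - sin x ^+ m.+1 * cos x) / m.+2%:R
  end.

Lemma nat_ind2 (P : nat -> Prop) :
  P 0%N -> P 1%N -> (forall n, P n -> P n.+2) -> forall n, P n.
Proof.
move=> P0 P1 PS n; suff [] : P n /\ P n.+1 by [].
by elim: n => // n [Pn PSn]; split => //; exact: PS.
Qed.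

Lemma is_derive_sin_prim {R : realType} (n : nat) (x : R) :
  is_derive x 1 (sin_prim n) (sin x ^+ n).
Proof.
elim/nat_ind2: n => [||n IHn].
- rewrite expr0; exact: is_derive_id.
- rewrite expr1 -[sin x]opprK -[- - sin x]add0r.
  exact: is_deriveB.
- pose f := n.+2%:R^-1 \*: (n.+1%:R \*: (sin_prim n : R -> R)
              - (@sin R) ^+ n.+1 * (@cos R)).
  have -> : sin_prim n.+2 = f :> (R -> R).
    apply/funext => y; rewrite /f /= mulrC; congr (_ * (_ - _ * _)).
    by rewrite exprfctE.
  apply: is_derive_eq.
  rewrite exprfctE /= /GRing.scale /=.
  apply: (mulfI (x := n.+2%:R)); first by rewrite pnatr_eq0.
  rewrite mulVKf ?pnatr_eq0//.
  have c2 : cos x * cos x = 1 - sin x * sin x.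
    by have := cos2Dsin2 x; rewrite !expr2 => <-; ring.
  rewrite -!natr1 !exprS.
  transitivity ((n%:R + 1) * sin x ^+ n + sin x * sin x ^+ n * sin x
     - (n%:R + 1) * sin x ^+ n * (cos x * cos x)); first by ring.
  by rewrite c2; ring.
Qed.

Lemma sin_prim0 {R : realType} (n : nat) : sin_prim n (0 : R) = 0.
Proof.
by elim/nat_ind2: n => [||n IHn] //=; rewrite ?cos0 ?subrr// IHn sin0 exprS; ring.
Qed.

Definition wallis {R : realType} (n : nat) : R := sin_prim n (pi / 2).

Lemma wallisSS {R : realType} (n : nat) :
  wallis n.+2 = n.+1%:R / n.+2%:R * wallis n :> R.
Proof. by rewrite /wallis /= cos_pihalf mulr0 subr0 mulrAC. Qed.

Lemma wallis_gt0 {R : realType} (n : nat) : 0 < wallis n :> R.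
Proof.
elim/nat_ind2: n => [||n IHn].
- by rewrite /wallis /= divr_gt0 ?pi_gt0.
- by rewrite /wallis /= cos_pihalf subr0.
- by rewrite wallisSS mulr_gt0// divr_gt0.
Qed.

(** sin_prim n - sin_prim n.+1 has derivative sin^n (1 - sin) >= 0 on
    [0, pi/2] and vanishes at 0. *)
Lemma wallis_decr {R : realType} (n : nat) : wallis n.+1 <= wallis n :> R.
Proof.
pose f : R -> R := sin_prim n - sin_prim n.+1.
have fD (x : R) : is_derive x 1 f (sin x ^+ n - sin x ^+ n.+1).
  by apply: is_deriveB; exact: is_derive_sin_prim.
rewrite -subr_ge0.
have p0 : 0 <= pi / 2 :> R by rewrite divr_ge0 ?pi_ge0.
have <- : f 0 = 0 by rewrite /f !fctE !sin_prim0 subrr.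
apply: (@ger0_derive1_le_cc _ f 0 (pi / 2)) => //.
- move=> x; rewrite in_itv /= => /andP[x0 xp].
  rewrite derive1E derive_val exprS -[X in X - _]mul1r -mulrBl.
  have s0 : 0 <= sin x by rewrite ltW// sin_gt0_pihalf// x0.
  by rewrite mulr_ge0 ?exprn_ge0// subr_ge0 sin_le1.
- by apply: derivable_within_continuous => x _; exact: ex_derive.
- by rewrite in_itv /= lexx.
- by rewrite in_itv /= lexx p0.
Qed.

(** By [wallisSS], n.+1 W_n W_(n+1) does not depend on n; W_0 W_1 = pi/2. *)
Lemma wallisM {R : realType} (n : nat) :
  wallis n * wallis n.+1 = pi / 2 / n.+1%:R :> R.
Proof.
elim: n => [|n IHn]; first by rewrite /wallis /= cos_pihalf subr0 mulr1 divr1.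
rewrite wallisSS mulrCA [wallis n.+1 * _]mulrC IHn; field.
by rewrite nat1r -(natrD _ 2 n) !pnatr_eq0.
Qed.

Lemma wallis_sqr_le {R : realType} (n : nat) :
  n.+1%:R * wallis n.+1 ^+ 2 <= pi / 2 :> R.
Proof.
rewrite -ler_pdivlMl// mulrC -wallisM expr2 ler_pM2r ?wallis_gt0//.
exact: wallis_decr.
Qed.

Lemma wallis_sqr_ge {R : realType} (n : nat) :
  pi / 2 <= n.+1%:R * wallis n ^+ 2 :> R.
Proof.
rewrite -ler_pdivrMl// mulrC -wallisM expr2 ler_pM2l ?wallis_gt0//.
exact: wallis_decr.
Qed.

(** * Central binomial coefficients *)

Definition cbin (k : nat) : nat := 'C(k, k./2).

Lemma cbin_odd (m : nat) : (m.+1 * cbin m.*2.+1 = m.*2.+1 * cbin m.*2)%N.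
Proof.
rewrite /cbin /= uphalf_double doubleK.
have := mul_bin_down m.*2.+1 m; rewrite /= => ->.
by rewrite -addnn subSn ?leq_addr// addnK.
Qed.

Lemma cbin_even (m : nat) : cbin m.*2.+2 = (2 * cbin m.*2.+1)%N.
Proof.
rewrite /cbin /= uphalf_double doubleK.
apply/eqP; rewrite -(eqn_pmul2l (ltn0Sn m)).
rewrite -[(m.+1 * 'C(m.*2.+2, _))%N]mul_bin_diag.
by rewrite /= -doubleS -muln2 mulnA.
Qed.

(** Both sides equal 1 at m = 0 and are multiplied by
    2 (2m + 1) / (m + 1) when m increases by one. *)
Lemma cbin_wallis {R : realType} (m : nat) :
  (cbin m.*2)%:R = 2 ^+ m.*2 * (2 / pi) * wallis m.*2 :> R.
Proof.
have p0 : pi != 0 :> R by rewrite gt_eqF ?pi_gt0.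
elim: m => [|m IHm].
  rewrite /wallis /cbin /= expr0 mul1r -invf_div mulVf//.
  by rewrite mulf_neq0// invr_neq0.
have m0 : m.+1%:R != 0 :> R by rewrite pnatr_eq0.
rewrite doubleS cbin_even natrM wallisSS.
have -> : (cbin m.*2.+1)%:R = m.*2.+1%:R * (cbin m.*2)%:R / m.+1%:R :> R.
  by rewrite -natrM -cbin_odd natrM mulrAC mulfV// mul1r.
rewrite IHm !exprS -doubleS -(muln2 m.+1) natrM.
move: (wallis m.*2) (pi : R) p0 => w p p0; field.
by rewrite nat1r m0.
Qed.

Lemma cbin_wallis_odd {R : realType} (m : nat) :
  (cbin m.*2.+1)%:R = 2 ^+ m.*2.+1 * (2 / pi) * wallis m.*2.+2 :> R.
Proof.
have := @cbin_wallis R m.+1; rewrite doubleS cbin_even natrM exprS -!mulrA.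
by apply: mulfI; rewrite pnatr_eq0.
Qed.

(** The parity of k only decides which Wallis integral appears: j is k for
    even k and k.+1 for odd k. Either way j is close enough to k to leave the
    leading constant 2/pi of the squared estimates intact. *)
Lemma cbin_sqr_wallis {R : realType} (k : nat) : exists2 j : nat,
  (k <= j <= k.+1)%N &
  (cbin k)%:R ^+ 2 = 4 ^+ k * (2 / pi) ^+ 2 * wallis j ^+ 2 :> R.
Proof.
have e4 : 4 = 2 ^+ 2 :> R by rewrite -natrX.
rewrite e4 -exprM mulnC exprM -exprMn -(odd_double_half k).
case: (odd k) => /=; rewrite ?add1n ?add0n.
- by exists k./2.*2.+2; rewrite ?leqnn ?leqnSn ?cbin_wallis_odd ?exprMn.
- by exists k./2.*2; rewrite ?leqnn ?leqnSn ?cbin_wallis ?exprMn.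
Qed.

Lemma cbin_sqr_le {R : realType} (k : nat) : (0 < k)%N ->
  (cbin k)%:R ^+ 2 <= 2 / pi * (4 ^+ k / k%:R) :> R.
Proof.
move=> k0; have [j /andP[kj _] ->] := @cbin_sqr_wallis R k.
have p0 : 0 < pi :> R := pi_gt0 R.
have kR : 0 < k%:R :> R by rewrite ltr0n.
have kw : k%:R * wallis j ^+ 2 <= pi / 2 :> R.
  case: j kj => [|j] kj; first by rewrite leqn0 in kj; rewrite (eqP kj) in k0.
  apply: le_trans (wallis_sqr_le j).
  by rewrite ler_wpM2r ?sqr_ge0// ler_nat.
rewrite mulrA ler_pdivlMr//.
have -> : 2 / pi * 4 ^+ k = 4 ^+ k * (2 / pi) ^+ 2 * (pi / 2) :> R.
  by move: (pi : R) (lt0r_neq0 p0) => p ?; field.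
rewrite -[leLHS]mulrA [_ * k%:R]mulrC ler_pM2l//.
by rewrite mulr_gt0 ?exprn_gt0 ?divr_gt0.
Qed.

Lemma cbin_sqr_ge {R : realType} (k : nat) :
  2 / pi * (4 ^+ k / k.+2%:R) <= (cbin k)%:R ^+ 2 :> R.
Proof.
have [j /andP[_ jk] ->] := @cbin_sqr_wallis R k.
have p0 : 0 < pi :> R := pi_gt0 R.
have kw : pi / 2 <= k.+2%:R * wallis j ^+ 2 :> R.
  apply: le_trans (wallis_sqr_ge j) _.
  by rewrite ler_wpM2r ?sqr_ge0// ler_nat ltnS.
rewrite mulrA ler_pdivrMr//.
have -> : 2 / pi * 4 ^+ k = 4 ^+ k * (2 / pi) ^+ 2 * (pi / 2) :> R.
  by move: (pi : R) (lt0r_neq0 p0) => p ?; field.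
rewrite -[leRHS]mulrA [_ * k.+2%:R]mulrC ler_pM2l//.
by rewrite mulr_gt0 ?exprn_gt0 ?divr_gt0.
Qed.

(** * The lower branch of the Lambert function *)

Lemma lambertWm1_spec {R : realType} (y : R) : - expR (-1) <= y < 0 ->
  lambertWm1 y <= -1 /\ lambertWm1 y * expR (lambertWm1 y) = y.
Proof.
move=> yI; split; last by apply: lambertWm1K; rewrite in_itv.
have [+ _ _] := @lambertWm1_set_bij R.
by move=> /(_ y); rewrite /= !in_itv; exact.
Qed.

Lemma lambertWm1_le {R : realType} (y a : R) :
  - expR (-1) <= y < 0 -> a <= -1 -> (lambertWm1 y <= a) = (a * expR a <= y).
Proof.
move=> /lambertWm1_spec; set w := lambertWm1 y => -[w1 wy] a1.
case: (ltgtP w a) => [wa|aw|wa].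
- by rewrite -wy ltW// mul_expR_decr.
- by rewrite leNgt -[X in X < _]wy mul_expR_decr.
- by rewrite -wa wy lexx.
Qed.

Lemma lambertWm1_ge {R : realType} (y a : R) :
  - expR (-1) <= y < 0 -> a <= -1 -> (a <= lambertWm1 y) = (y <= a * expR a).
Proof.
move=> /lambertWm1_spec; set w := lambertWm1 y => -[w1 wy] a1.
case: (ltgtP a w) => [aw|wa|wa].
- by rewrite -wy ltW// mul_expR_decr.
- by rewrite leNgt -[X in _ < X]wy mul_expR_decr.
- by rewrite wa wy lexx.
Qed.

(** This crude bound puts - (2 * ln 2) * k in the domain w <= -1 of the lower
    branch as soon as k >= 1. *)
Lemma ln2_ge_half {R : realType} : 2^-1 <= ln 2 :> R.
Proof.
rewrite -ler_expR lnK ?posrE// -[leLHS]invrK -expRN.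
rewrite -[leRHS]invrK lef_pV2 ?posrE ?invr_gt0 ?expR_gt0//.
by have := @expR_ge1Dx R (- 2^-1); lra.
Qed.

(** The substitution w = - (2 * ln 2) * k under which w e^w becomes a multiple
    of k / 4^k, the quantity controlled by the estimates of [cbin]. *)
Lemma mul_expR_ln2 {R : realType} (k : nat) : (0 < k)%N ->
  (- (2 * ln 2) * k%:R) * expR (- (2 * ln 2) * k%:R)
   = - (2 * ln 2) / (4 ^+ k / k%:R) :> R.
Proof.
move=> k0.
have -> : 4 = expR (2 * ln 2) :> R.
  by rewrite mulr_natl mulr2n expRD lnK ?posrE// -natrM.
rewrite -expRM_natr mulNr expRN; field.
by rewrite pnatr_eq0 -lt0n k0 gt_eqF// expR_gt0.
Qed.

Lemma div_sqr_small {R : realType} (c d : R) : 0 <= c -> 0 < d ->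
  exists N : nat, forall n, (1 <= n)%N -> (N <= n)%N -> c / n%:R ^+ 2 <= d.
Proof.
move=> c0 d0; exists (Num.truncn (c / d)).+1 => n n1 Nn.
have n1' : 1 <= n%:R :> R by rewrite ler1n.
have cn : c / d <= n%:R.
  by rewrite ltW// (lt_le_trans (truncnS_gt _))// ler_nat.
rewrite ler_pdivrMr ?exprn_gt0 ?(lt_le_trans ltr01)//.
rewrite mulrC -ler_pdivrMr// (le_trans cn)// expr2 ler_peMl//.
Qed.

Lemma lambertWm1_dom_eventually {R : realType} (c : R) : 0 < c ->
  exists N : nat, forall n, (1 <= n)%N -> (N <= n)%N ->
    - expR (-1) <= - (c / n%:R ^+ 2) < 0.
Proof.
move=> c0; have [N HN] := div_sqr_small (ltW c0) (expR_gt0 (-1)).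
exists N => n n1 Nn; rewrite lerN2 HN// oppr_lt0 divr_gt0// exprn_gt0//.
by rewrite ltr0n.
Qed.

(** * The two bounds on s *)

Lemma s_gt0 n : (0 < s n)%N.
Proof. by rewrite /s; case: ex_minnP => k /andP[]. Qed.

Lemma le_cbin_s n : (n <= cbin (s n))%N.
Proof. by rewrite /s; case: ex_minnP => k /andP[]. Qed.

Lemma s_min n k : (0 < k)%N -> (n <= cbin k)%N -> (s n <= k)%N.
Proof.
by move=> k0 nk; rewrite /s; case: ex_minnP => j _; apply; rewrite k0.
Qed.

(** From n^2 <= b(k)^2 <= 2/pi * 4^k/k at k = s n: the real solution of
    2/pi * 4^x/x = n^2 lies below k, because 4^x/x increases. *)
Lemma lambertWm1_le_s {R : realType} (n : nat) (y : R) : (1 <= n)%N ->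
  y = - (4 * ln 2 / pi / n%:R ^+ 2) -> - expR (-1) <= y < 0 ->
  -1 / (2 * ln 2) * lambertWm1 y <= (s n)%:R.
Proof.
move=> n1 yE yI; have l2 := @ln2_ge_half R.
have k0 := s_gt0 n; set k := s n in k0 *.
have k1 : 1 <= k%:R :> R by rewrite ler1n.
have p0 : 0 < pi :> R := pi_gt0 R.
have n0 : 0 < n%:R ^+ 2 :> R by rewrite exprn_gt0// ltr0n.
rewrite mulN1r mulNr lerNl ler_pdivlMl; last by lra.
rewrite mulrN -mulNr lambertWm1_ge//; last by nra.
rewrite mul_expR_ln2// yE mulNr lerN2.
have nb : n%:R ^+ 2 <= (cbin k)%:R ^+ 2 :> R.
  by rewrite -!natrX ler_nat leq_exp2r// le_cbin_s.
have g0 : 0 < 4 ^+ k / k%:R :> R by rewrite divr_gt0 ?exprn_gt0// ltr0n.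
have := le_trans nb (cbin_sqr_le k0).
move: (4 ^+ k / k%:R) (n%:R ^+ 2) (pi : R) g0 n0 p0 => g m p g0 m0 p0 mg.
rewrite ler_pdivrMr// mulrAC ler_pdivlMr//.
have -> : 4 * ln 2 / p * g = 2 * ln 2 * (2 / p * g) :> R by ring.
by rewrite ler_pM2l//; lra.
Qed.

(** The slack between a and 2/pi absorbs the ratio (k+2)/k, which tends
    to 1. *)
Lemma cbin_sqr_ge_eventually {R : realType} (a : R) : 0 <= a < 2 / pi ->
  exists K : nat, forall k, (0 < k)%N -> (K <= k)%N ->
    a * (4 ^+ k / k%:R) <= (cbin k)%:R ^+ 2.
Proof.
move=> /andP[a0 ap]; set c := 2 / pi in ap.
have d0 : 0 < c - a by rewrite subr_gt0.
(* The bound on k solves a * (k + 2) <= c * k for k. *)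
exists (Num.truncn (2 * a / (c - a))).+1 => k k0 Kk.
have kR : 0 < k%:R :> R by rewrite ltr0n.
apply: le_trans (cbin_sqr_ge k); rewrite -/c.
rewrite !mulrA ler_pdivrMr// mulrAC ler_pdivlMr ?ltr0n//.
rewrite mulrAC [leRHS]mulrAC ler_pM2r ?exprn_gt0//.
have : 2 * a / (c - a) <= k%:R.
  by rewrite ltW// (lt_le_trans (truncnS_gt _))// ler_nat.
by rewrite ler_pdivrMr// -(addn2 k) natrD; lra.
Qed.

(** At k = ceil x, where x is the real solution of a * 4^x/x = n^2, the
    eventual lower estimate gives b(k)^2 >= a * 4^k/k >= n^2. It applies only
    to large k, so n must also be large enough to force x above a given
    threshold. *)
Lemma s_le_ceil_lambertWm1 {R : realType} (a : R) : 0 < a < 2 / pi ->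
  exists N : nat, forall n : nat, (1 <= n)%N -> (N <= n)%N ->
  (s n)%:Z <= Num.ceil (-1 / (2 * ln 2) *
     lambertWm1 (- (2 * a * ln 2 / n%:R ^+ 2)) : R).
Proof.
move=> /andP[a0 ap]; have l2 := @ln2_ge_half R.
have [|K HK] := @cbin_sqr_ge_eventually _ a; first by rewrite ltW.
have c0 : 0 < 2 * a * ln 2 by rewrite !mulr_gt0//; lra.
have [N1 HN1] := lambertWm1_dom_eventually c0.
(* The threshold K.+1, unlike K, is at least 1, so that - (2 * ln 2) * K.+1
   lies in the domain of the lower branch. *)
have gK0 : 0 < 2 * ln 2 / (4 ^+ K.+1 / K.+1%:R) :> R.
  by rewrite divr_gt0 ?divr_gt0 ?exprn_gt0//; lra.
have [N2 HN2] := div_sqr_small (ltW c0) gK0.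
exists (maxn N1 N2) => n n1; rewrite geq_max => /andP[nN1 nN2].
have yI := HN1 n n1 nN1; have small := HN2 n n1 nN2.
set y := - (_ / _) in yI *; set x := _ * lambertWm1 y.
have wx : lambertWm1 y = - (2 * ln 2) * x.
  by rewrite /x; field; rewrite gt_eqF//; lra.
have K1 : 1 <= K.+1%:R :> R by rewrite ler1n.
have Kx : K.+1%:R <= x.
  have : lambertWm1 y <= - (2 * ln 2) * K.+1%:R.
    rewrite lambertWm1_le//; last by nra.
    by rewrite mul_expR_ln2// mulNr lerN2.
  by rewrite wx ler_nM2l//; lra.
have [k kE] : exists k : nat, Num.ceil x = k%:Z.
  exists `|Num.ceil x|%N; rewrite gez0_abs// ceil_ge0.
  by apply: lt_le_trans Kx; lra.
have xk : x <= k%:R by have := ceil_ge x; rewrite kE.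
have Kk : (K.+1 <= k)%N by rewrite -(ler_nat R) (le_trans Kx).
have k0 : (0 < k)%N := leq_ltn_trans (leq0n K) Kk.
have k1 : 1 <= k%:R :> R by rewrite ler1n.
rewrite kE lez_nat; apply: s_min => //.
rewrite -(@leq_exp2r _ _ 2)// -(ler_nat R) !natrX.
apply: le_trans (HK k k0 (ltnW Kk)).
have : - (2 * ln 2) * k%:R <= lambertWm1 y by rewrite wx ler_nM2l//; lra.
rewrite lambertWm1_ge//; last by nra.
rewrite mul_expR_ln2// mulNr lerN2.
have n0 : 0 < n%:R ^+ 2 :> R by rewrite exprn_gt0// ltr0n.
have g0 : 0 < 4 ^+ k / k%:R :> R by rewrite divr_gt0 ?exprn_gt0// ltr0n.
move: (4 ^+ k / k%:R) (n%:R ^+ 2) g0 n0 => g m g0 m0.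
rewrite ler_pdivrMr// mulrAC ler_pdivlMr//.
have -> : 2 * a * ln 2 * g = (2 * ln 2) * (a * g) by ring.
by rewrite ler_pM2l//; lra.
Qed.

Theorem theorem4p3 (R : realType) (eps : R) (eps_gt0 : 0 < eps)
    (eps_lt : eps < Num.sqrt (2 / pi)) :
  let alpha : R := Num.sqrt (2 / pi) - eps in
  exists N : nat, forall n : nat, (1 <= n)%N -> (N <= n)%N ->
    Num.ceil (-1 / (2 * ln 2) *
       lambertWm1 (- 4 * ln 2 / (pi * n%:R ^+ 2)) : R) <= (s n)%:Z /\
    (s n)%:Z <= Num.ceil (-1 / (2 * ln 2) *
       lambertWm1 (- 2 * alpha ^+ 2 * ln 2 / n%:R ^+ 2) : R).
Proof.
move=> alpha; have l2 := @ln2_ge_half R.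
have p0 : 0 < pi :> R := pi_gt0 R.
have alpha2 : 0 < alpha ^+ 2 < 2 / pi.
  have a0 : 0 < alpha by rewrite subr_gt0.
  rewrite exprn_gt0//= -[ltRHS]sqr_sqrtr ?divr_ge0 ?ltW//.
  by rewrite ltr_pXn2r ?nnegrE ?sqrtr_ge0 ?ltW// /alpha ltrBlDr ltrDl.
have c0 : 0 < 4 * ln 2 / pi :> R by rewrite divr_gt0//; lra.
have [N1 HN1] := lambertWm1_dom_eventually c0.
have [N2 HN2] := s_le_ceil_lambertWm1 alpha2.
exists (maxn N1 N2) => n n1; rewrite geq_max => /andP[nN1 nN2]; split.
- rewrite ceil_le_int.
  have -> : - 4 * ln 2 / (pi * n%:R ^+ 2) = - (4 * ln 2 / pi / n%:R ^+ 2) :> R.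
    by rewrite invfM !mulNr !mulrA.
  exact: lambertWm1_le_s n1 erefl (HN1 n n1 nN1).
- by have := HN2 n n1 nN2; rewrite -!mulNr.
Qed.
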